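(* Let $n\ge 3$ be odd. If $\frac{n+1}{2}$ is odd, then $\mathcal{SD}_n=\{A\in\mathrm{SGL}_n(\mathbb{F}_2): d(A,I_n)=\frac{n+5}{2},\ \widehat d(A,I_n)=\frac{n+1}{2}\}$. If $\frac{n+1}{2}$ is even, then $\mathcal{SD}_n=\{A\in\mathrm{SGL}_n(\mathbb{F}_2): d(A,I_n)=\frac{n+5}{2},\ \widehat d(A,I_n)\in\{\frac{n+1}{2},\frac{n+3}{2}\}\}$.
   Context: $\mathbb{F}_2$ is the binary field; $S_n(\mathbb{F}_2)$ is the set of symmetric $n\times n$ matrices over $\mathbb{F}_2$ and $\mathrm{SGL}_n(\mathbb{F}_2)$ its subset of invertible ones. $\widehat\Gamma_n$ is the graph on $S_n(\mathbb{F}_2)$ with $A\sim B$ iff $\mathrm{rank}(A-B)=1$, with graph distance $\widehat d$; $\Gamma_n$ is its induced subgraph on $\mathrm{SGL}_n(\mathbb{F}_2)$, with graph distance $d$. $\mathcal{SD}_n=\{A\in\mathrm{SGL}_n(\mathbb{F}_2): d(A,I_n)=\frac{n+5}{2},\ \mathrm{rank}(A-I_n)=\frac{n+1}{2}\}$. *)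

(* Defs.v *)
From HB Require Import structures.
From mathcomp Require Import all_boot all_order all_algebra.
Set Implicit Arguments. Unset Strict Implicit. Unset Printing Implicit Defensive.
Import GRing.Theory.
Local Open Scope ring_scope.

Fixpoint walkn (T : finType) (P : pred T) (e : rel T) (k : nat) (x y : T) : bool :=
  match k with
  | 0 => P x && (x == y)
  | k'.+1 => P x && [exists z : T, e x z && walkn P e k' z y]
  end.

Definition gdist_is (T : finType) (P : pred T) (e : rel T) (x y : T) (k : nat) : bool :=
  walkn P e k x y && [forall j : 'I_k, ~~ walkn P e j x y].

Definition symF2 (n : nat) : pred 'M['F_2]_n := fun A => A^T == A.
Definition SGL (n : nat) : pred 'M['F_2]_n := fun A => symF2 A && (A \in unitmx).

Definition rank1_adj (n : nat) : rel 'M['F_2]_n := fun A B => \rank (A - B) == 1%N.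

Definition dhat_is (n : nat) (A B : 'M['F_2]_n) (k : nat) : bool :=
  gdist_is (@symF2 n) (@rank1_adj n) A B k.
Definition d_is (n : nat) (A B : 'M['F_2]_n) (k : nat) : bool :=
  gdist_is (@SGL n) (@rank1_adj n) A B k.

Definition SD (n : nat) : pred 'M['F_2]_n := fun A =>
  [&& SGL A, d_is A 1%:M ((n + 5) %/ 2) & \rank (A - 1%:M) == ((n + 1) %/ 2)%N].

(* Main.v *)
Require Import Defs.
From mathcomp Require Import all_boot all_order all_algebra.
(** The form u^T S u of a symmetric matrix S over F_2 is additive in u, so it is
    the dot product of u with the diagonal of S; S is alternate when its diagonal
    vanishes. A rank-one symmetric matrix is x x^T, hence a walk of length k from
    A amounts to an n x k matrix X with endpoint A + X X^T. A non-alternate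
    symmetric matrix of rank k is X X^T with X of size n x k, and an alternate one
    has even rank; this gives dhat(A, B) = rank(A - B), plus one when A - B is
    alternate and nonzero. It remains to exclude rank(A - I) = (n+3)/2 when this
    number is odd, and A - I alternate of rank (n-1)/2.

    The main point is that if A - I = X X^T has odd rank r and the Gram matrix
    X^T X has rank at least 2, then d(A, I) = r. Suppose a walk from I to A has
    reached B, with remaining difference X X^T of rank r, and let G = X^T B^-1 X.
    The step to B + (X x)(X x)^T stays invertible when x is orthogonal to the
    diagonal of G, and lowers the rank of the remaining difference when 1.x = 1.
    There are at least 2^(r-2) such x, and at most five of them lead to a pair
    from which the induction cannot continue. If rank(A - I) = (n+3)/2 is odd, the
    Gram matrix has rank at least 3, so d(A, I) = (n+3)/2 < (n+5)/2. If A - I is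
    alternate of rank (n-1)/2, one step y y^T with y outside the image of A - I
    reduces to the main point, so d(A, I) <= (n+3)/2. *)

Set Implicit Arguments. Unset Strict Implicit. Unset Printing Implicit Defensive.
Import GRing.Theory.
Local Open Scope ring_scope.

(** * Arithmetic of matrices over the binary field *)

Lemma F2_case (a : 'F_2) : a = 0 \/ a = 1.
Proof. by case: a => [[|[|]]] //= h; [left|right]; apply: val_inj. Qed.

Lemma F2_neq0 (a : 'F_2) : a != 0 -> a = 1.
Proof. by case: (F2_case a) => -> //; rewrite eqxx. Qed.

Lemma addmm (m n : nat) (A : 'M['F_2]_(m, n)) : A + A = 0.
Proof.
by apply/matrixP=> i j; rewrite !mxE; case: (F2_case (A i j)) => ->; apply: val_inj.
Qed.

Lemma oppmx2 (m n : nat) (A : 'M['F_2]_(m, n)) : - A = A.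
Proof. by apply/eqP; rewrite eq_sym -addr_eq0 addmm. Qed.

Lemma addmKr (m n : nat) (A B : 'M['F_2]_(m, n)) : A + (A + B) = B.
Proof. by rewrite addrA addmm add0r. Qed.

Lemma addm_eq0 (m n : nat) (A B : 'M['F_2]_(m, n)) : (A + B == 0) = (A == B).
Proof. by rewrite addr_eq0 oppmx2. Qed.

Lemma mx11_case (a : 'M['F_2]_1) : a = 0 \/ a = 1.
Proof.
by rewrite [a]mx11_scalar; case: (F2_case (a 0 0)) => ->; [left|right];
  rewrite ?raddf0.
Qed.

Lemma mx11_neq0 (a : 'M['F_2]_1) : a != 0 -> a = 1.
Proof. by case: (mx11_case a) => -> //; rewrite eqxx. Qed.

Lemma tr_mx11 (a : 'M['F_2]_1) : a^T = a.
Proof. by apply/matrixP=> i j; rewrite mxE !ord1. Qed.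

Lemma trmxD (m n : nat) (A B : 'M['F_2]_(m, n)) : (A + B)^T = A^T + B^T.
Proof. exact: raddfD. Qed.

Lemma dotC (n : nat) (u v : 'cV['F_2]_n) : u^T *m v = v^T *m u.
Proof. by rewrite -[LHS]tr_mx11 trmx_mul trmxK. Qed.

(** * Diagonals and quadratic forms *)

Definition dg (n : nat) (S : 'M['F_2]_n) : 'cV['F_2]_n := \col_i S i i.

Lemma dgD (n : nat) (S S' : 'M['F_2]_n) : dg (S + S') = dg S + dg S'.
Proof. by apply/matrixP=> i j; rewrite !mxE. Qed.

Lemma dg1 (n : nat) : dg (1%:M : 'M['F_2]_n) = const_mx 1.
Proof. by apply/matrixP=> i j; rewrite !mxE eqxx. Qed.

Lemma F2_sqr (a : 'F_2) : a * a = a.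
Proof. by case: (F2_case a) => ->; rewrite ?mulr0 ?mulr1. Qed.

Lemma dg_mul_tr (n k : nat) (X : 'M['F_2]_(n, k)) :
  dg (X *m X^T) = X *m const_mx 1.
Proof.
apply/matrixP=> i j; rewrite !mxE; apply: eq_bigr => l _.
by rewrite !mxE mulr1 F2_sqr.
Qed.

Lemma dg_outer (n : nat) (x : 'cV['F_2]_n) : dg (x *m x^T) = x.
Proof.
rewrite dg_mul_tr; apply/matrixP=> i j.
by rewrite !mxE big_ord1 mxE mulr1 (ord1 j).
Qed.

(* The off-diagonal terms of the quadratic form come in equal pairs, so it is
   additive, and it equals the linear form given by the diagonal. *)
Lemma quad_dg (n : nat) (S : 'M['F_2]_n) (u : 'cV['F_2]_n) :
  S^T = S -> u^T *m S *m u = (dg S)^T *m u.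
Proof.
move=> symS.
have addq (v w : 'cV['F_2]_n) :
    (v + w)^T *m S *m (v + w) = v^T *m S *m v + w^T *m S *m w.
  rewrite trmxD !mulmxDl !mulmxDr.
  have -> : w^T *m S *m v = v^T *m S *m w.
    by rewrite -[LHS]tr_mx11 !trmx_mul trmxK symS mulmxA.
  by rewrite -addrA addmKr.
have -> : u = \sum_i u i 0 *: delta_mx i 0.
  by rewrite {1}[u]matrix_sum_delta; apply: eq_bigr => i _; rewrite big_ord1.
elim/big_ind: _ => [|v w Hv Hw|i _]; rewrite ?mulmx0 //.
  by rewrite addq mulmxDr Hv Hw.
case: (F2_case (u i 0)) => ->; rewrite ?scale0r ?mulmx0 // scale1r.
apply/matrixP=> a b; rewrite !ord1 trmx_delta -rowE -colE mxE mxE.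
by rewrite -colE !mxE.
Qed.

(** * Gram decompositions and the even rank of alternate matrices *)

Lemma rank_outer_le (n : nat) (x : 'cV['F_2]_n) : (\rank (x *m x^T) <= 1)%N.
Proof. exact: leq_trans (mxrankM_maxl _ _) (rank_leq_col _). Qed.

Lemma colvec_neq0P (n : nat) (d : 'cV['F_2]_n) :
  d != 0 -> exists i, d i 0 = 1.
Proof.
move=> /eqP d0; case: (pickP (fun i => d i 0 != 0)) => [i|h].
  by move/F2_neq0; exists i.
case: d0; apply/matrixP=> i j; rewrite (ord1 j) mxE; apply/eqP.
by move/negbT: (h i); rewrite negbK.
Qed.

Lemma dot_delta (n : nat) (d : 'cV['F_2]_n) i :
  d^T *m delta_mx i 0 = (d i 0)%:M.
Proof. by apply/matrixP=> a b; rewrite !ord1 -colE !mxE mulr1n. Qed.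

Lemma eq_mulmx_cV (m n : nat) (A B : 'M['F_2]_(m, n)) :
  (forall u : 'cV['F_2]_n, A *m u = B *m u) -> A = B.
Proof.
move=> h; apply/matrixP=> i j.
by have /matrixP/(_ i 0) := h (delta_mx j 0); rewrite -!colE !mxE.
Qed.

Lemma unitmx_inj (n : nat) (M : 'M['F_2]_n) (u v : 'cV['F_2]_n) :
  M \in unitmx -> M *m u = M *m v -> u = v.
Proof. by move=> Mu e; rewrite -(mulKmx Mu u) e mulKmx. Qed.

Lemma dot_neq0 (n : nat) (d : 'cV['F_2]_n) :
  d != 0 -> exists u : 'cV['F_2]_n, d^T *m u = 1.
Proof.
by case/colvec_neq0P=> i di; exists (delta_mx i 0); rewrite dot_delta di.
Qed.

(* If every u with d.u = 1 had S u = d, then S would be d d^T. *)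
Lemma nonradial_vector (n : nat) (S : 'M['F_2]_n) :
  S^T = S -> dg S != 0 -> S != dg S *m (dg S)^T ->
  exists2 u : 'cV['F_2]_n, (dg S)^T *m u = 1 & S *m u != dg S.
Proof.
move=> symS d0 nS; set d := dg S in d0 nS *.
case: (pickP (fun u : 'cV['F_2]_n => (d^T *m u == 1) && (S *m u != d))) => [u|h].
  by case/andP=> /eqP; exists u.
have {}h (u : 'cV['F_2]_n) : d^T *m u = 1 -> S *m u = d.
  by move=> du; move: (h u); rewrite du eqxx => /negbT; rewrite negbK => /eqP.
case/eqP: nS; apply: eq_mulmx_cV => u; rewrite -mulmxA.
have [u0 du0] := dot_neq0 d0.
case: (mx11_case (d^T *m u)) => du; rewrite du; last by rewrite mulmx1 h.
have /h : d^T *m (u + u0) = 1 by rewrite mulmxDr du du0 add0r.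
by rewrite mulmxDr (h _ du0) mulmx0 => /(canRL (addrK _)); rewrite subrr.
Qed.

Lemma sym_outer (n : nat) (x : 'cV['F_2]_n) : (x *m x^T)^T = x *m x^T.
Proof. by rewrite trmx_mul trmxK. Qed.

Lemma symD (n : nat) (S S' : 'M['F_2]_n) : S^T = S -> S'^T = S' -> (S + S')^T = S + S'.
Proof. by rewrite trmxD => -> ->. Qed.

(** The new matrix kills [u] and its row space lies in that of [S]; as [u^T S u = 1], the inclusion
    is strict. A rank-one change lowers the rank by at most one. *)
Lemma rank_sub_outer (n k : nat) (S : 'M['F_2]_n) (u : 'cV['F_2]_n) :
  S^T = S -> \rank S = k.+1 -> u^T *m S *m u = 1 ->
  \rank (S + (S *m u) *m (S *m u)^T)%R = k.
Proof.
move=> symS rS uSu; set y := S *m u; set S' := S + _.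
have eS : S = S' + y *m y^T by rewrite /S' -addrA addmm addr0.
have S'u : S' *m u = 0.
  rewrite /S' mulmxDl -mulmxA -(_ : u^T *m S *m u = y^T *m u) ?uSu ?mulmx1 ?addmm //.
  by rewrite /y trmx_mul symS.
have S'S : (S' <= S)%MS.
  have -> : S' = (1%:M + y *m u^T) *m S.
    by rewrite mulmxDl mul1mx -mulmxA /S' {2}/y trmx_mul symS.
  exact: submxMl.
apply/eqP; rewrite eqn_leq -ltnS -{1}rS; apply/andP; split.
  have [_ e] := mxrank_leqif_eq S'S.
  rewrite ltn_neqAle mxrankS // andbT e; apply/negP=> /andP[_ /submxP[T eT]].
  by move: uSu; rewrite eT -!mulmxA S'u !mulmx0 => /eqP; rewrite eq_sym oner_eq0.
rewrite -ltnS -rS {1}eS.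
by rewrite (leq_trans (mxrank_add _ _)) // -[X in (_ <= X)%N]addn1 leq_add2l rank_outer_le.
Qed.

(** Columns [S u] are split off one at a time. The remainder has diagonal [dg S + S u], and
    [nonradial_vector] supplies [u] with this nonzero, so the induction goes on until [S] is [d d^T]
    with [d = dg S]. *)
Lemma gram_decomposition (k n : nat) (S : 'M['F_2]_n) :
  S^T = S -> \rank S = k -> (k != 0%N -> dg S != 0) ->
  exists Y : 'M['F_2]_(n, k), S = Y *m Y^T.
Proof.
elim: k S => [|k IHk] S symS rS dS.
  by exists 0; rewrite mul0mx; apply/eqP; rewrite -mxrank_eq0 rS.
have {}dS := dS isT.
case: (eqVneq S (dg S *m (dg S)^T)) => [eS|nS].
  have k0 : k = 0%N.
    by apply/eqP; rewrite -leqn0 -ltnS -rS eS rank_outer_le.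
  by rewrite k0; exists (dg S).
have [u du nu] := nonradial_vector symS dS nS.
have uSu : u^T *m S *m u = 1 by rewrite quad_dg.
have [|||Y eY] := IHk (S + (S *m u) *m (S *m u)^T).
- exact/symD/sym_outer.
- exact: rank_sub_outer.
- by move=> _; rewrite dgD dg_outer addm_eq0 eq_sym nu.
have eS : S = row_mx (S *m u) Y *m (row_mx (S *m u) Y)^T.
  by rewrite tr_row_mx mul_row_col -eY addrCA addmm addr0.
by exists (row_mx (S *m u) Y).
Qed.

Lemma const1_neq0 (k : nat) : (const_mx 1 : 'cV['F_2]_k.+1) != 0.
Proof.
by apply/eqP=> /matrixP/(_ 0 0); rewrite !mxE => /eqP; rewrite oner_eq0.
Qed.

Lemma dot_ones (k : nat) :
  (const_mx 1 : 'cV['F_2]_k)^T *m const_mx 1 = (odd k)%:R%:M.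
Proof.
apply/matrixP=> i j; rewrite !ord1 !mxE.
rewrite (eq_bigr (fun=> 1)) => [|l _]; last by rewrite !mxE mulr1.
rewrite sumr_const card_ord mulr1n -{1}(odd_double_half k) natrD -muln2 natrM.
by rewrite (_ : 2%:R = 0 :> 'F_2) ?mulr0 ?addr0 //; apply: val_inj.
Qed.

Lemma rank_mul_unitr (m n : nat) (S : 'M['F_2]_(m, n)) (Q : 'M['F_2]_n) :
  Q \in unitmx -> \rank (S *m Q) = \rank S.
Proof. by move=> Qu; rewrite mxrankMfree // row_free_unit. Qed.

(** Take [y = S u]. Then [S + y y^T = S (1 + u y^T)], and [u y^T] squares to zero because
    [y^T u = u^T S u = 0], so the second factor is an involution. *)
Lemma alternate_add_outer (n : nat) (S : 'M['F_2]_n) :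
  S^T = S -> dg S = 0 -> S != 0 ->
  exists2 y : 'cV['F_2]_n, y != 0 & \rank (S + y *m y^T)%R = \rank S.
Proof.
move=> symS dS S0.
have [u yn0] : exists u : 'cV['F_2]_n, S *m u != 0.
  apply/existsP; apply: contraNT S0; rewrite negb_exists => /forallP h.
  apply/eqP; apply: eq_mulmx_cV => u; rewrite mul0mx; apply/eqP.
  by move: (h u); rewrite negbK.
exists (S *m u) => //; set y := S *m u in yn0 *.
have uSu : u^T *m S *m u = 0 by rewrite quad_dg // dS trmx0 mul0mx.
have yT : y^T = u^T *m S by rewrite trmx_mul symS.
have -> : S + y *m y^T = S *m (1%:M + u *m y^T).
  by rewrite mulmxDr mulmx1 mulmxA.
apply: rank_mul_unitr; set P := _ + _.
suff : P *m P = 1%:M by case/mulmx1_unit.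
have QQ : (u *m y^T) *m (u *m y^T) = 0.
  by rewrite -mulmxA (mulmxA y^T) {1}yT uSu mul0mx mulmx0.
by rewrite /P mulmxDl mul1mx mulmxDr mulmx1 QQ addr0 -addrA addmm addr0.
Qed.

(* Adding a suitable y y^T makes S non-alternate without changing its rank;
   writing the result as Z Z^T gives y = Z 1 and S = Z (1 + 1 1^T) Z^T. *)
Lemma alternate_rank_even (n : nat) (S : 'M['F_2]_n) :
  S^T = S -> dg S = 0 -> ~~ odd (\rank S).
Proof.
move=> symS dS; apply/negP=> oddS.
have S0 : S != 0 by apply: contraL oddS => /eqP->; rewrite mxrank0.
have [y yn0 rSy] := alternate_add_outer symS dS S0.
have [|Z eZ] := gram_decomposition (symD symS (sym_outer y)) rSy.
  by rewrite dgD dS add0r dg_outer.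
have yZ : y = Z *m const_mx 1 by rewrite -dg_mul_tr -eZ dgD dS add0r dg_outer.
pose o : 'cV['F_2]_(\rank S) := const_mx 1.
have eS : S = Z *m (1%:M + o *m o^T) *m Z^T.
  rewrite mulmxDr mulmx1 mulmxDl -eZ mulmxA -mulmxA -trmx_mul -yZ.
  by rewrite -addrA addmm addr0.
have : \rank S = \rank (1%:M + o *m o^T)%R.
  apply/eqP; rewrite eqn_leq rank_leq_row andbT {1}eS.
  exact: leq_trans (mxrankM_maxl _ _) (mxrankM_maxr _ _).
move/esym/eqP; rewrite -/(row_free _) row_free_unit => Qu.
have : o = 0.
  apply: (unitmx_inj Qu); rewrite mulmx0 mulmxDl mul1mx -mulmxA dot_ones oddS.
  by rewrite mulmx1 addmm.
rewrite /o; case: (\rank S) oddS => // k _ /eqP.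
by apply/negP; exact: const1_neq0.
Qed.

Lemma unit_odd_dg_neq0 (r : nat) (M : 'M['F_2]_r) :
  M^T = M -> M \in unitmx -> odd r -> dg M != 0.
Proof.
move=> symM Mu oddr; apply/eqP => /(alternate_rank_even symM).
by rewrite mxrank_unit // oddr.
Qed.

Lemma odd_rank_dg_neq0 (r : nat) (M : 'M['F_2]_r) :
  M^T = M -> odd (\rank M) -> dg M != 0.
Proof. by move=> symM; apply: contraL => /eqP/(alternate_rank_even symM). Qed.

Lemma rank1_outer (n : nat) (S : 'M['F_2]_n) :
  S^T = S -> \rank S = 1%N -> exists x : 'cV['F_2]_n, S = x *m x^T.
Proof.
move=> symS rS; apply: gram_decomposition => // _.
by apply: odd_rank_dg_neq0; rewrite ?rS.
Qed.

Lemma rank_outer (n : nat) (x : 'cV['F_2]_n) : x != 0 -> \rank (x *m x^T) = 1%N.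
Proof.
move=> x0; apply/eqP; rewrite eqn_leq rank_outer_le lt0n mxrank_eq0.
by apply: contra x0 => /eqP e; rewrite -(dg_outer x) e;
  apply/eqP/matrixP=> i j; rewrite !mxE.
Qed.

(** * Walks, and their lengths in the graph of all symmetric matrices *)

Lemma walkn_rcons (T : finType) (P : pred T) (e : rel T) k x y z :
  walkn P e k x z -> e z y -> P y -> walkn P e k.+1 x y.
Proof.
elim: k x => [|k IHk] x /=.
  move=> /andP[Px /eqP <-] exy Py; rewrite Px; apply/existsP; exists y.
  by rewrite exy Py eqxx.
move=> /andP[Px /existsP[t /andP[ext wt]]] ezy Py; rewrite Px.
by apply/existsP; exists t; rewrite ext; apply: IHk.
Qed.

Lemma walkn_rev (T : finType) (P : pred T) (e : rel T) k x y :
  symmetric e -> walkn P e k x y -> walkn P e k y x.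
Proof.
move=> syme; elim: k x => [|k IHk] x /=.
  by move=> /andP[Px /eqP <-]; rewrite Px eqxx.
move=> /andP[Px /existsP[z /andP[exz /IHk w]]].
by apply: walkn_rcons w _ Px; rewrite syme.
Qed.

Lemma rank1_adj_sym (n : nat) : symmetric (@rank1_adj n).
Proof. by move=> A B; rewrite /rank1_adj -mxrank_opp opprB. Qed.

Lemma rank1_adj_outer (n : nat) (A : 'M['F_2]_n) (x : 'cV['F_2]_n) :
  x != 0 -> rank1_adj A (A + x *m x^T).
Proof.
by move=> x0; rewrite /rank1_adj opprD addNKr mxrank_opp rank_outer.
Qed.

Lemma gdist_is_uniq (T : finType) (P : pred T) (e : rel T) x y k l :
  gdist_is P e x y k -> gdist_is P e x y l -> k = l.
Proof.
move=> /andP[wk /forallP mk] /andP[wl /forallP ml].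
by case: (ltngtP k l) => // [kl|lk]; [move: (ml (Ordinal kl))|move: (mk (Ordinal lk))];
  rewrite /= ?wk ?wl.
Qed.

Lemma gdist_is_le (T : finType) (P : pred T) (e : rel T) x y k l :
  gdist_is P e x y k -> walkn P e l x y -> (k <= l)%N.
Proof.
move=> /andP[_ /forallP mk] wl; rewrite leqNgt; apply/negP=> lk.
by move: (mk (Ordinal lk)); rewrite /= wl.
Qed.

Lemma walkn_gram (n k : nat) (A B : 'M['F_2]_n) :
  walkn (@symF2 n) (@rank1_adj n) k A B ->
  exists X : 'M['F_2]_(n, k), A = B + X *m X^T.
Proof.
elim: k A => [|k IHk] A /=.
  by move=> /andP[_ /eqP <-]; exists 0; rewrite mul0mx addr0.
move=> /andP[/eqP symA /existsP[C /andP[/eqP rAC wCB]]].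
have symC : C^T = C by case: (k) wCB => [|?] /= /andP[/eqP].
have [X eX] := IHk _ wCB.
have [|//|x ex] := @rank1_outer n (A - C); first by rewrite oppmx2 symD.
have eA : A = B + row_mx x X *m (row_mx x X)^T.
  rewrite tr_row_mx mul_row_col addrCA -eX -ex subrK //.
by exists (row_mx x X).
Qed.

(** The columns of [X] are removed one by one. Full column rank makes the first column nonzero, so
    its removal is an edge, and passes to the remaining columns. *)
Lemma gram_walkn (n k : nat) (B : 'M['F_2]_n) (X : 'M['F_2]_(n, k)) :
  B^T = B -> \rank X = k ->
  walkn (@symF2 n) (@rank1_adj n) k (B + X *m X^T) B.
Proof.
move=> symB; elim: k X => [|k IHk] X rX /=.
  by rewrite /symF2 (flatmx0 X^T) mulmx0 addr0 symB !eqxx.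
rewrite /symF2 symD ?eqxx //; last by rewrite trmx_mul trmxK.
pose x : 'cV_n := lsubmx (X : 'M_(n, 1 + k)).
pose X' : 'M_(n, k) := rsubmx (X : 'M_(n, 1 + k)).
have eX : X = row_mx x X' by rewrite hsubmxK.
have eXX : X *m X^T = x *m x^T + X' *m X'^T.
  by rewrite eX; rewrite (tr_row_mx x X') (mul_row_col x X').
have rXk : (k.+1 <= \rank x + \rank X')%N.
  rewrite -[k.+1]rX -mxrank_tr eX (tr_row_mx x X') -(mxrank_tr x) -(mxrank_tr X').
  have h : (\rank (col_mx x^T X'^T) <= \rank x^T + \rank X'^T)%N.
    by rewrite -addsmxE mxrank_adds_leqif.
  exact: h.
have rx : (\rank x <= 1)%N := rank_leq_col x.
have rX' : \rank X' = k.
  apply/eqP; rewrite eqn_leq rank_leq_col -ltnS.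
  by apply: leq_trans rXk _; rewrite -[X in (_ <= X)%N]add1n leq_add2r.
have x0 : x != 0.
  apply: contraL rXk => /eqP ->.
  by rewrite mxrank0 add0n rX' ltnn.
apply/existsP; exists (B + X' *m X'^T); rewrite IHk // andbT eXX.
by rewrite rank1_adj_sym addrCA [x *m _ + _]addrC rank1_adj_outer.
Qed.

Lemma dhat_le_rank (n k : nat) (A B : 'M['F_2]_n) :
  A^T = A -> B^T = B -> \rank (A - B) = k -> dg (A - B) != 0 ->
  walkn (@symF2 n) (@rank1_adj n) k A B.
Proof.
move=> symA symB; rewrite oppmx2 => rk dAB.
have [//|Y eY] := gram_decomposition (symD symA symB) rk.
have rY : \rank Y = k.
  apply/eqP; rewrite eqn_leq rank_leq_col -[X in (X <= _)%N]rk eY; exact: mxrankM_maxl.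
have -> : A = B + Y *m Y^T by rewrite -eY addrCA addmm addr0.
exact: gram_walkn.
Qed.

Lemma walkn_rank_le (n k : nat) (A B : 'M['F_2]_n) :
  walkn (@symF2 n) (@rank1_adj n) k A B -> (\rank (A - B)%R <= k)%N.
Proof.
move=> /walkn_gram[X ->]; rewrite addrC addKr.
exact: leq_trans (mxrankM_maxl _ _) (rank_leq_col _).
Qed.

(** A walk of length k gives [A - B = X X^T], whose diagonal is [X 1]. Rank k would make [X]
    injective on column vectors, hence this diagonal nonzero. *)
Lemma walkn_alternate_rank_lt (n k : nat) (A B : 'M['F_2]_n) :
  (0 < k)%N -> walkn (@symF2 n) (@rank1_adj n) k A B -> dg (A - B) = 0 ->
  (\rank (A - B)%R < k)%N.
Proof.
move=> k0 w; move: (walkn_rank_le w); rewrite leq_eqVlt => /orP[/eqP rk|//].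
case/walkn_gram: w rk => X ->; rewrite addrC addKr => rk.
rewrite dg_mul_tr => X1; exfalso.
have fX : row_free X^T.
  by rewrite /row_free mxrank_tr eqn_leq rank_leq_col -[X in (X <= _)%N]rk mxrankM_maxl.
have : (const_mx 1 : 'cV['F_2]_k)^T = 0.
  by apply: (row_free_inj fX); rewrite mul0mx -trmx_mul X1 trmx0.
case: (k) k0 => // k' _ /(congr1 trmx); rewrite trmxK trmx0 => /eqP.
by apply/negP/const1_neq0.
Qed.

(* A first step by y y^T with y = (A - B) u makes the difference non-alternate
   and keeps its rank. *)
Lemma dhat_le_rank_alternate (n k : nat) (A B : 'M['F_2]_n) :
  A^T = A -> B^T = B -> \rank (A - B) = k -> (0 < k)%N -> dg (A - B) = 0 ->
  walkn (@symF2 n) (@rank1_adj n) k.+1 A B.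
Proof.
move=> symA symB; rewrite oppmx2 => rk k0 dS.
have [|y y0 rSy] := alternate_add_outer (symD symA symB) dS.
  by rewrite -mxrank_eq0 rk -lt0n.
have e : (A + y *m y^T) - B = A + B + y *m y^T by rewrite oppmx2 addrAC.
rewrite /= /symF2 symA eqxx /=; apply/existsP; exists (A + y *m y^T).
rewrite rank1_adj_outer //=; apply: dhat_le_rank => //.
- exact/symD/sym_outer.
- by rewrite e rSy rk.
- by rewrite e dgD dS add0r dg_outer.
Qed.

(** * Choice of a step: counting and small sizes *)

(** There are at most [2 ^ m] fibres, and each nonempty one is a translate of the fibre through
    [x0]. *)
Lemma card_fiber_mulmx (m r : nat) (C : 'M['F_2]_(m, r)) (x0 : 'cV['F_2]_r) :
  (2 ^ r <= #|[set x | C *m x == C *m x0]| * 2 ^ m)%N.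
Proof.
have card2 k : #|{: 'cV['F_2]_k}| = (2 ^ k)%N by rewrite card_mx card_Fp // muln1.
rewrite -(card2 r) -(card2 m) mulnC -sum_nat_const -[X in (X <= _)%N]sum1_card.
rewrite (partition_big (fun x : 'cV_r => C *m x) predT) //=; apply: leq_sum => c _.
rewrite sum1dep_card; set F := [set x | _].
have [->|[x1]] := set_0Vmem F; first by rewrite cards0.
rewrite inE => /eqP Cx1.
rewrite -(card_imset F (addrI (x0 - x1))) subset_leq_card //.
apply/subsetP=> y /imsetP[x]; rewrite !inE => /eqP Cx ->.
by rewrite mulmxDr mulmxBr Cx Cx1 subrK.
Qed.

Lemma subset_seq_card (T : finType) (A : {set T}) (s : seq T) :
  (forall x, x \in A -> x \in s) -> (#|A| <= size s)%N.
Proof.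
by move=> h; apply: leq_trans (card_size s); apply/subset_leq_card/subsetP.
Qed.

Lemma outer_pair_eq0 (r : nat) (z y : 'cV['F_2]_r) :
  (z == 0) || (y == 0) -> z *m y^T + y *m z^T = 0.
Proof. by case/orP=> /eqP->; rewrite ?trmx0 ?mul0mx ?mulmx0 addr0. Qed.

(* R = (x + d) (R x)^T + (R x) (x + d)^T puts x + d among the three nonzero
   vectors of the image of R, which is two-dimensional. *)
Lemma resonant_seq (r : nat) (R : 'M['F_2]_r) (d : 'cV['F_2]_r) :
  R != 0 ->
  exists2 s : seq 'cV['F_2]_r, (size s <= 3)%N &
    forall x, R = (x + d) *m (R *m x)^T + (R *m x) *m (x + d)^T -> x \in s.
Proof.
move=> R0.
pose bad x := R == (x + d) *m (R *m x)^T + (R *m x) *m (x + d)^T.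
case: (pickP bad) => [x0 /eqP|none]; last first.
  by exists [::] => // x /eqP ex; move: (none x); rewrite /bad ex.
set a := x0 + d; set b := R *m x0 => eR.
exists [:: a + d; b + d; (a + b) + d] => // x ex.
set z := x + d in ex; set y := R *m x in ex.
have /norP[z0 y0] : ~~ ((z == 0) || (y == 0)).
  by apply: contra R0 => /outer_pair_eq0 e; rewrite ex e.
have [t yt] := dot_neq0 y0.
have [t' zt] : exists t', z = R *m t'.
  have Rt : R *m t = z + y *m (z^T *m t).
    by rewrite {1}ex mulmxDl -!mulmxA yt mulmx1.
  case: (mx11_case (z^T *m t)) => e; move: Rt; rewrite e ?mulmx0 ?mulmx1 ?addr0.
    by move=> <-; exists t.
  by move=> Rt; exists (t + x); rewrite mulmxDr Rt -/y -addrA addmm addr0.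
have {}zt : z = a *m (b^T *m t') + b *m (a^T *m t').
  by rewrite zt {1}eR mulmxDl -!mulmxA.
have -> : x = z + d by rewrite /z -addrA addmm addr0.
rewrite !inE.
case: (mx11_case (b^T *m t')) zt => ->; case: (mx11_case (a^T *m t')) => ->;
  rewrite ?mulmx0 ?mulmx1 ?addr0 ?add0r => e; rewrite e ?eqxx ?orbT //.
by rewrite e eqxx in z0.
Qed.

(** In size 3 counting guarantees only two candidates, and two vectors must be avoided, so basis
    vectors are tried instead. If all fail, invertibility of [1 + G] leaves a single i with
    [G i i = 0]; row and column i of [G] vanish, and the other 2 x 2 block, where [1 + G] has zero
    diagonal, must consist of ones. Then [G = d d^T] with [d = dg G]. *)
Lemma pivot_exists3 (G : 'M['F_2]_3) :
  G^T = G -> 1%:M + G \in unitmx -> dg G != const_mx 1 ->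
  G != dg G *m (dg G)^T ->
  exists x : 'cV['F_2]_3,
    [/\ (const_mx 1)^T *m x = 1, (dg G)^T *m x = 0, x != const_mx 1 &
        (1%:M + G) *m x != const_mx 1 + dg G].
Proof.
move=> symG Mu dn Gn; set M := 1%:M + G in Mu *.
set o : 'cV['F_2]_3 := const_mx 1 in dn *.
have symGE i j : G i j = G j i by rewrite -{1}symG mxE.
case: (pickP (fun i => (G i i == 0) && (M *m delta_mx i 0 != o + dg G))) => [i|h].
  move=> /andP[/eqP Gi Mi]; exists (delta_mx i 0); split=> //.
  - by rewrite dot_delta mxE.
  - by rewrite dot_delta mxE Gi raddf0.
  - apply/eqP=> /matrixP e.
    have [j ji] : exists j : 'I_3, j != i.
      by case: i {Gi Mi e} => [[|[|[]]] ? //]; [exists 1|exists 0|exists 0].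
    move: (e j 0); rewrite !mxE (negbTE ji) /= => /eqP.
    by rewrite eq_sym oner_eq0.
have {}h i : G i i = 0 -> M *m delta_mx i 0 = o + dg G.
  by move=> Gi; move: (h i); rewrite Gi eqxx => /negbT; rewrite negbK => /eqP.
have [i] : exists i, (o + dg G) i 0 = 1.
  by apply: colvec_neq0P; rewrite addm_eq0 eq_sym.
rewrite !mxE => Gi.
have {}Gi : G i i = 0.
  by case: (F2_case (G i i)) Gi => -> // /eqP; rewrite addrC -subr_eq0 addrK oner_eq0.
have Gj j : j != i -> G j j = 1.
  move=> ji; case: (F2_case (G j j)) => // Gj; case/eqP: ji.
  have e : delta_mx j 0 = delta_mx i 0 :> 'cV['F_2]_3.
    by apply: (unitmx_inj Mu); rewrite !h.
  move/matrixP/(_ j 0): e; rewrite !mxE eqxx andbT.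
  by case: eqP => // _ /eqP; rewrite oner_eq0.
have Gji j : j != i -> G j i = 0.
  move=> ji; have /matrixP/(_ j 0) := h i Gi.
  rewrite -colE !mxE (Gj _ ji) (negbTE ji) add0r => ->.
  by apply: val_inj.
case/eqP: Gn; apply/matrixP=> a b; rewrite !mxE big_ord1 !mxE.
case: (eqVneq a i) => [->|ai].
  rewrite Gi mul0r; case: (eqVneq b i) => [->//|bi]; by rewrite symGE Gji.
case: (eqVneq b i) => [->|bi]; first by rewrite Gi mulr0 Gji.
rewrite !Gj // mulr1.
case: (eqVneq a b) => [->|ab]; first exact: Gj.
have : col b M != 0.
  apply/eqP; rewrite colE => Mb.
  have e : delta_mx b 0 = 0 :> 'cV['F_2]_3.
    by apply: (unitmx_inj Mu); rewrite Mb mulmx0.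
  move/matrixP/(_ b 0): e; by rewrite !mxE !eqxx => /eqP; rewrite oner_eq0.
case/colvec_neq0P=> l; rewrite !mxE.
case: (eqVneq l b) => [->|lb]; first by rewrite Gj // => /eqP.
case: (eqVneq l i) => [->|li]; first by rewrite symGE Gji // addr0 => /eqP.
rewrite add0r => <-; congr (G _ _).
move: ai bi ab lb li {Gi Gj Gji}.
case: i => [[|[|[|?]]] ?] //; case: a => [[|[|[|?]]] ?] //;
  case: b => [[|[|[|?]]] ?] //; case: l => [[|[|[|?]]] ?] // *; exact: val_inj.
Qed.

(* After the step given by x, the third and fourth conditions keep 1 + x x^T and
   the next 1 + G non-alternate (the latter holds automatically when its size r is
   odd), and the fifth keeps the next G different from dg G (dg G)^T. *)
Lemma pivot_exists (r : nat) (G : 'M['F_2]_r.+1) :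
  G^T = G -> 1%:M + G \in unitmx -> dg G != const_mx 1 ->
  ((2 <= r)%N -> G != dg G *m (dg G)^T) ->
  let R := G + dg G *m (dg G)^T in
  exists x : 'cV['F_2]_r.+1,
    [/\ (const_mx 1)^T *m x = 1, (dg G)^T *m x = 0,
        (0 < r)%N -> x != const_mx 1,
        (0 < r)%N -> ~~ odd r -> (1%:M + G) *m x != const_mx 1 + dg G &
        (3 <= r)%N -> R != (x + dg G) *m (R *m x)^T + (R *m x) *m (x + dg G)^T].
Proof.
move=> symG Mu dn Gn R; set M := 1%:M + G in Mu *.
set o : 'cV['F_2]_r.+1 := const_mx 1 in dn *.
have [i] : exists i, (o + dg G) i 0 = 1.
  by apply: colvec_neq0P; rewrite addm_eq0 eq_sym.
rewrite !mxE => Gi.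
have {}Gi : G i i = 0.
  by case: (F2_case (G i i)) Gi => -> // /eqP; rewrite addrC -subr_eq0 addrK oner_eq0.
pose e : 'cV['F_2]_r.+1 := delta_mx i 0.
have oe : o^T *m e = 1 by rewrite dot_delta mxE.
have de : (dg G)^T *m e = 0 by rewrite dot_delta mxE Gi raddf0.
have o_even x : odd r -> o^T *m x = 1 -> x != o.
  move=> oddr; apply: contra_eqN => /eqP->; rewrite dot_ones /= oddr raddf0.
  by rewrite eq_sym oner_eq0.
pose T := [set x : 'cV['F_2]_r.+1 | (o^T *m x == 1) && ((dg G)^T *m x == 0)].
have cardT : (2 ^ r.+1 <= #|T| * 4)%N.
  have := card_fiber_mulmx (col_mx o^T (dg G)^T) e.
  rewrite (_ : [set x | _] = T) //; apply/setP=> x; rewrite !inE !mul_col_mx oe de.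
  apply/eqP/andP=> [/eq_col_mx[-> ->] //|[/eqP-> /eqP->] //].
case: (leqP r 1) => [r1|r1].
  have odd01 : (0 < r)%N -> odd r by move=> r0; have /eqP-> : r == 1%N by rewrite eqn_leq r1.
  exists e; split=> //.
  - by move=> r0; apply: o_even => //; rewrite odd01.
  - by move=> r0; rewrite odd01.
  - by move=> r3; move: (leq_trans r3 r1).
have {}Gn := Gn r1.
case: (eqVneq r 2) => [r2|r2].
  subst r.
  have [x [h1 h2 h3 h4]] := pivot_exists3 symG Mu dn Gn.
  by exists x; split.
have r3 : (3 <= r)%N by rewrite ltn_neqAle eq_sym r2.
have [|s s3 bad_s] := @resonant_seq _ R (dg G); first by rewrite /R addm_eq0.
(* For odd r the size [r.+1] is even, so [o] is orthogonal to itself and is not in [T], and the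
   fourth condition is vacuous: three vectors to avoid against at least 4 in [T]. For even r there
   are five, against at least 8. *)
pose avoid := if odd r then s else o :: invmx M *m (o + dg G) :: s.
have [x xT xs] : exists2 x, x \in T & x \notin avoid.
  apply/exists_inP; apply: contraLR cardT; rewrite negb_exists_in -ltnNge => /forall_inP h.
  have sT : (#|T| <= size avoid)%N.
    by apply: subset_seq_card => x /h; rewrite negbK.
  case: (eqVneq r 3) => [er|nr].
    have oddr : odd r by rewrite er.
    have -> : (2 ^ r.+1 = 4 * 4)%N by rewrite er.
    by move: sT; rewrite /avoid oddr => sT; rewrite ltn_mul2r (leq_ltn_trans sT).
  have r4 : (4 <= r)%N by rewrite ltn_neqAle eq_sym nr.
  have sA : (size avoid <= 5)%N by rewrite /avoid; case: ifP => _ /=; rewrite ?(leq_trans s3).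
  apply: (@leq_trans (5 * 4).+1); first by rewrite ltnS leq_mul2r (leq_trans sT).
  by apply: (@leq_trans (2 ^ 5)%N) => //; rewrite leq_exp2l.
move: xT; rewrite inE => /andP[/eqP ox /eqP dx]; exists x; split=> //.
- move=> _; case: (boolP (odd r)) => [oddr|ev]; first exact: o_even.
  by apply: contra xs => /eqP->; rewrite /avoid (negbTE ev) !inE eqxx.
- move=> _ ev; apply: contra xs => /eqP ex; rewrite /avoid (negbTE ev) !inE -ex.
  by rewrite mulKmx // eqxx orbT.
- move=> _; apply: contra xs => /eqP /bad_s xs; rewrite /avoid; case: ifP => // _.
  by rewrite !inE xs !orbT.
Qed.

(** * Rank-one updates of inverses, and walks through invertible matrices *)

Lemma mulmx1_invmx (n : nat) (A B : 'M['F_2]_n) :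
  A *m B = 1%:M -> A \in unitmx /\ invmx A = B.
Proof.
move=> AB; have [Au _] := mulmx1_unit AB; split=> //.
by rewrite -[LHS]mulmx1 -AB mulKmx.
Qed.

(** This is the Sherman-Morrison formula; its denominator [1 + y^T A^-1 y] equals 1 here. *)
Lemma add_outer_unit (n : nat) (A : 'M['F_2]_n) (y : 'cV['F_2]_n) :
  A \in unitmx -> y^T *m invmx A *m y = 0 ->
  A + y *m y^T \in unitmx /\
  invmx (A + y *m y^T) = invmx A + invmx A *m (y *m (y^T *m invmx A)).
Proof.
move=> Au yAy; apply: mulmx1_invmx.
set b := y^T *m invmx A.
have h : y *m y^T *m (invmx A *m (y *m b)) = 0.
  by rewrite -mulmxA (mulmxA y^T) (mulmxA (y^T *m invmx A)) yAy mul0mx mulmx0.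
rewrite mulmxDl !mulmxDr h mulmxV // mulKVmx // -mulmxA addr0.
by rewrite -addrA addmm addr0.
Qed.

(* The Woodbury inverse is 1 + X^T (A + X X^T)^-1 X. *)
Lemma gram_unit (n r : nat) (A : 'M['F_2]_n) (X : 'M['F_2]_(n, r)) :
  A \in unitmx -> A + X *m X^T \in unitmx ->
  1%:M + X^T *m invmx A *m X \in unitmx.
Proof.
set B := A + _ => Au Bu.
suff e : (1%:M + X^T *m invmx A *m X) *m (1%:M + X^T *m invmx B *m X) = 1%:M.
  by have [Mu _] := mulmx1_unit e; exact: Mu.
have XX : X *m X^T = A + B by rewrite /B addmKr.
have h : X^T *m invmx A *m X *m (X^T *m invmx B *m X) =
         X^T *m invmx A *m X + X^T *m invmx B *m X.
  have -> : X^T *m invmx A *m X *m (X^T *m invmx B *m X) =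
            X^T *m (invmx A *m (X *m X^T) *m invmx B) *m X by rewrite !mulmxA.
  rewrite XX mulmxDr mulVmx // mulmxDl mul1mx mulmxK //.
  by rewrite mulmxDr mulmxDl addrC.
by rewrite mulmxDl mul1mx mulmxDr mulmx1 h addmKr -addrA addmm addr0.
Qed.

Lemma sym_invmx (n : nat) (A : 'M['F_2]_n) : A^T = A -> (invmx A)^T = invmx A.
Proof. by move=> symA; rewrite trmx_inv symA. Qed.

Lemma sym_conj (n k : nat) (S : 'M['F_2]_n) (Y : 'M['F_2]_(n, k)) :
  S^T = S -> (Y^T *m S *m Y)^T = Y^T *m S *m Y.
Proof. by move=> symS; rewrite !trmx_mul trmxK symS mulmxA. Qed.

(** The form of [Y^T S Y] at z is the form of [S] at [Y z]. *)
Lemma dg_conj (n k : nat) (S : 'M['F_2]_n) (Y : 'M['F_2]_(n, k)) :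
  S^T = S -> dg (Y^T *m S *m Y) = Y^T *m dg S.
Proof.
move=> symS; apply: trmx_inj; apply: eq_mulmx_cV => z.
rewrite -quad_dg ?sym_conj // trmx_mul trmxK -[RHS]mulmxA -quad_dg //.
by rewrite trmx_mul !mulmxA.
Qed.

Lemma row_free_trmx (n r : nat) (X : 'M['F_2]_(n, r)) : \rank X = r -> row_free X^T.
Proof. by move=> rX; rewrite /row_free mxrank_tr rX. Qed.

Lemma mulmx_rank_inj (n r k : nat) (X : 'M['F_2]_(n, r)) (U V : 'M['F_2]_(r, k)) :
  \rank X = r -> X *m U = X *m V -> U = V.
Proof.
move=> /row_free_trmx fX e; apply: trmx_inj; apply: (row_free_inj fX).
by rewrite -!trmx_mul e.
Qed.

Lemma SGL_symP (n : nat) (A : 'M['F_2]_n) :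
  reflect (A^T = A /\ A \in unitmx) (SGL A).
Proof. by apply: (iffP andP) => -[/eqP]. Qed.

(** Induction on r: a step along [X x] leaves a difference generated by r - 1 columns, and the
    conditions on x from [pivot_exists] restore both conditions on [G]. If [dg G] were the all-ones
    vector, no x could satisfy [1.x = 1] and [dg G . x = 0]. *)
Lemma SGL_gram_walk (r n : nat) (A : 'M['F_2]_n) (X : 'M['F_2]_(n, r)) :
  let G := X^T *m invmx A *m X in
  SGL A -> \rank X = r -> A + X *m X^T \in unitmx ->
  ((0 < r)%N -> dg G != const_mx 1) ->
  ((3 <= r)%N -> G != dg G *m (dg G)^T) ->
  walkn (@SGL n) (@rank1_adj n) r A (A + X *m X^T).
Proof.
elim: r A X => [|r IHr] A X G sglA rX Bu dn Gn.
  by rewrite (flatmx0 X^T) mulmx0 addr0 /= sglA eqxx.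
have [symA Au] := SGL_symP _ sglA.
have symG : G^T = G by apply/sym_conj/sym_invmx.
have Mu : 1%:M + G \in unitmx by apply: gram_unit.
have [|x [ox dx xo Mx Rx]] := pivot_exists symG Mu (dn isT).
  by move=> r2; apply: Gn.
set o : 'cV['F_2]_r.+1 := const_mx 1 in ox xo Mx.
set d := dg G in dx Mx Rx; set R := G + _ in Rx.
have xx : x^T *m x = 1.
  by rewrite -[x^T]mulmx1 quad_dg ?trmx1 // dg1.
have xd : x^T *m d = 0 by rewrite dotC.
have xo1 : x^T *m o = 1 by rewrite dotC.
have xGx : x^T *m G *m x = 0 by rewrite quad_dg.
set y := X *m x.
have y0 : y != 0.
  apply/eqP=> e; have x0 : x = 0 by apply: (mulmx_rank_inj rX); rewrite mulmx0.
  by move/eqP: ox; rewrite x0 mulmx0 eq_sym oner_eq0.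
have yAy : y^T *m invmx A *m y = 0.
  by rewrite trmx_mul -xGx !mulmxA.
have [A1u A1inv] := add_outer_unit Au yAy.
set A1 := A + y *m y^T in A1u A1inv.
have sglA1 : SGL A1 by apply/SGL_symP; split=> //; exact/symD/sym_outer.
rewrite /= sglA; apply/existsP; exists A1; rewrite rank1_adj_outer //=.
(* The remaining difference is [X E X^T]. Since [x.x = 1], [E] is the projection along x onto its
   orthogonal complement, and [E = Y Y^T] with [Y^T Y = 1]. *)
set E := 1%:M + x *m x^T.
have rE : \rank E = r.
  have := @rank_sub_outer _ r 1%:M x; rewrite !mul1mx; apply.
  - exact: trmx1.
  - exact: mxrank1.
  - by rewrite mulmx1.
have [||Y eE] := @gram_decomposition r _ E _ rE.
- by apply: symD; rewrite ?trmx1 ?sym_outer.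
- by rewrite -lt0n => /xo; rewrite dgD dg1 dg_outer addm_eq0 eq_sym.
have rY : \rank Y = r.
  apply/eqP; rewrite eqn_leq rank_leq_col.
  by rewrite -[X in (X <= _)%N]rE eE mxrankM_maxl.
have fY := row_free_trmx rY.
have xY : x^T *m Y = 0.
  apply: (row_free_inj fY).
  by rewrite mul0mx -mulmxA -eE mulmxDr mulmx1 mulmxA xx mul1mx addmm.
have Yx : Y^T *m x = 0 by apply: trmx_inj; rewrite trmx_mul trmxK xY trmx0.
have YY : Y^T *m Y = 1%:M.
  apply: (row_free_inj fY).
  by rewrite mul1mx -mulmxA -eE mulmxDr mulmx1 mulmxA Yx mul0mx addr0.
have eB : A1 + (X *m Y) *m (X *m Y)^T = A + X *m X^T.
  rewrite trmx_mul mulmxA -(mulmxA X) -eE mulmxDr mulmx1 mulmxDl.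
  rewrite mulmxA -mulmxA -trmx_mul -/y /A1 -addrA; congr (_ + _).
  by rewrite addrCA addmm addr0.
set S := G + (G *m x) *m (G *m x)^T.
have symS : S^T = S by apply/symD/sym_outer.
have eG1 : (X *m Y)^T *m invmx A1 *m (X *m Y) = Y^T *m S *m Y.
  have -> : S = X^T *m invmx A1 *m X.
    rewrite A1inv mulmxDr mulmxDl /S -/G; congr (_ + _).
    by rewrite trmx_mul symG /G /y trmx_mul !mulmxA.
  by rewrite trmx_mul !mulmxA.
have dS : dg S = d + G *m x by rewrite dgD dg_outer.
(* The kernel of [Y^T] is spanned by x. *)
have YE v : Y^T *m v = 0 -> v = x *m (x^T *m v).
  move=> Yv; have : E *m v = 0 by rewrite eE -mulmxA Yv mulmx0.
  by rewrite mulmxDl mul1mx -mulmxA => /eqP; rewrite addm_eq0 => /eqP.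
rewrite -eB; apply: (IHr _ _ sglA1); rewrite ?eG1.
- by rewrite -mxrank_tr trmx_mul mxrankMfree ?row_free_trmx // mxrank_tr.
- by rewrite eB; exact: Bu.
(* In odd size the invertible matrix 1 plus the new Gram matrix cannot be alternate. In even size,
   an all-ones diagonal would put [o + d + G x] in the kernel of [Y^T]; its product with x is 1, so
   it would equal x, which [Mx] excludes. *)
- move=> r0; case: (boolP (odd r)) => [oddr|ev].
    have : dg (1%:M + Y^T *m S *m Y) != 0.
      apply: unit_odd_dg_neq0; [| |exact: oddr].
        by apply: symD; rewrite ?trmx1 ?sym_conj.
      by rewrite -eG1; apply: (gram_unit A1u); rewrite eB; exact: Bu.
    by rewrite dgD dg1 addm_eq0 eq_sym.
  apply: contra (Mx r0 ev) => /eqP; rewrite dg_conj // dS.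
  have -> : const_mx 1 = Y^T *m o.
    by rewrite -dg1 -YY -[Y^T in LHS]mulmx1 dg_conj ?trmx1 // dg1.
  move/eqP; rewrite -addm_eq0 -mulmxDr => /eqP /YE.
  rewrite [x^T *m _]mulmxDr [x^T *m (_ + _)]mulmxDr xd (mulmxA x^T) xGx xo1.
  rewrite !add0r mulmx1 => e; apply/eqP.
  rewrite mulmxDl mul1mx -[X in X + _]e addrAC -[d + _ + _]addrA addmm addr0.
  exact: addrC.
(* If the new Gram matrix were the outer square of its diagonal, then [Y^T Z Y = 0] for [Z] below,
   hence [E Z E = 0] and [Z = x g^T + g x^T]. Since [R = Z + d g^T + g d^T], this is the equality
   excluded by [Rx]. *)
move=> r3; apply: contra (Rx r3) => /eqP; rewrite dg_conj // dS.
have RxE : R *m x = G *m x by rewrite mulmxDl -mulmxA dx mulmx0 addr0.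
set g := G *m x in dS RxE *; rewrite RxE => e.
have xg : x^T *m g = 0 by rewrite mulmxA.
have gx : g^T *m x = 0 by rewrite dotC.
set Z := S + (d + g) *m (d + g)^T.
have YZY : Y^T *m Z *m Y = 0.
  by rewrite mulmxDr mulmxDl e trmx_mul trmxK !mulmxA addmm.
have Zx : Z *m x = g.
  rewrite /Z /S mulmxDl mulmxDl -[_ *m _ *m x]mulmxA gx mulmx0 addr0 -/g.
  have h : (d + g)^T *m x = 0 by rewrite trmxD mulmxDl dx gx addr0.
  by rewrite -mulmxA h mulmx0 addr0.
have xZ : x^T *m Z = g^T.
  by rewrite -Zx trmx_mul symD // sym_outer.
have eZ : Z = x *m g^T + g *m x^T.
  have : E *m Z *m E = 0.
    by rewrite eE -!mulmxA (mulmxA Y^T) (mulmxA _ Y) YZY mul0mx mulmx0.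
  rewrite mulmxDl mul1mx -mulmxA xZ mulmxDr mulmx1 mulmxDl mulmxA Zx.
  rewrite -(mulmxA x) (mulmxA g^T) gx mul0mx mulmx0 addr0 -addrA.
  by move/eqP; rewrite addm_eq0 => /eqP.
have eR : R = Z + (d *m g^T + g *m d^T).
  rewrite /Z /S /R trmxD mulmxDl !mulmxDr -!addrA; congr (_ + _).
  rewrite -/g addrCA (addrA (d *m g^T)) (addrA (g *m g^T)) addmm addr0.
  by [].
by rewrite eR eZ mulmxDl trmxD mulmxDr addrACA.
Qed.

(** * Short walks between the identity and a given matrix *)

Lemma sym_mulmx_self (n : nat) (N : 'M['F_2]_n) : N^T = N -> (N *m N)^T = N *m N.
Proof. by move=> symN; rewrite trmx_mul symN. Qed.

(** For [K = c c^T], the value [p^T K p] is [p.c], and its vanishing forces [p^T K q = 0]. *)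
Lemma rank_gt1_isotropic (n : nat) (K : 'M['F_2]_n) (p q : 'cV['F_2]_n) :
  K^T = K -> p^T *m K *m p = 0 -> p^T *m K *m q = 1 -> (1 < \rank K)%N.
Proof.
move=> symK pp pq; rewrite ltnNge; apply/negP; rewrite leq_eqVlt ltnS leqn0.
case/orP=> [/eqP rK|]; last first.
  rewrite mxrank_eq0 => /eqP K0; move/eqP: pq.
  by rewrite K0 mulmx0 mul0mx eq_sym oner_eq0.
have [c eK] := rank1_outer symK rK; move: pp pq; rewrite eK !mulmxA -!(mulmxA _ c^T).
rewrite (dotC c p).
case: (mx11_case (p^T *m c)) => ->; rewrite ?mul0mx ?mul1mx => /eqP.
  by move=> _ /eqP; rewrite eq_sym oner_eq0.
by rewrite oner_eq0.
Qed.

(** Starting at the identity, the Gram matrix is [G = X^T X]. Odd r makes [1 + G] non-alternate, and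
    [G = d d^T] would give [N^2 = (X d)(X d)^T], of rank at most one. *)
Lemma SGL_walk_from_id (n r : nat) (B : 'M['F_2]_n) :
  SGL B -> \rank (B - 1%:M) = r -> odd r ->
  (1 < \rank ((B - 1%:M)%R *m (B - 1%:M)%R))%N ->
  walkn (@SGL n) (@rank1_adj n) r 1%:M B.
Proof.
move=> /SGL_symP[symB Bu]; set N := B - 1%:M => rN oddr rNN.
have symN : N^T = N by rewrite /N oppmx2; apply: symD; rewrite ?trmx1.
have [|X eX] := gram_decomposition symN rN.
  by move=> _; apply: odd_rank_dg_neq0; rewrite ?rN.
have rX : \rank X = r.
  apply/eqP; rewrite eqn_leq rank_leq_col -[X in (X <= _)%N]rN eX.
  exact: mxrankM_maxl.
have eB : B = 1%:M + X *m X^T by rewrite -eX /N addrCA subrr addr0.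
have sgl1 : SGL (1%:M : 'M['F_2]_n) by apply/SGL_symP; rewrite trmx1 unitmx1.
have Bu' : 1%:M + X *m X^T \in unitmx by rewrite -eB; exact: Bu.
have eG : X^T *m invmx 1%:M *m X = X^T *m X by rewrite invmx1 mulmx1.
rewrite eB; apply: SGL_gram_walk => //.
  move=> _; have : dg (1%:M + X^T *m invmx 1%:M *m X) != 0.
    apply: unit_odd_dg_neq0 oddr.
      by rewrite eG; apply: symD; rewrite ?trmx1 // trmx_mul trmxK.
    exact: (gram_unit (unitmx1 _ _) Bu').
  by rewrite dgD dg1 addm_eq0 eq_sym.
move=> _; apply/eqP; rewrite eG; set d := dg _ => eGd.
move: rNN; apply/negP; rewrite -leqNgt.
have -> : N *m N = (X *m d) *m (X *m d)^T.
  by rewrite eX -mulmxA (mulmxA X^T) eGd trmx_mul !mulmxA.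
exact: rank_outer_le.
Qed.

Lemma rank_le1_two_values (n : nat) (N : 'M['F_2]_n) (c : 'cV['F_2]_n) :
  (forall p : 'cV['F_2]_n, N *m p = 0 \/ N *m p = c) -> (\rank N <= 1)%N.
Proof.
move=> h; rewrite -mxrank_tr.
apply: leq_trans (rank_leq_row c^T); apply: mxrankS; apply/row_subP=> i.
rewrite -tr_col colE; case: (h (delta_mx i 0)) => ->; rewrite ?trmx0 ?sub0mx //.
Qed.

Lemma separating_vector (n : nat) (v w : 'cV['F_2]_n) :
  v != 0 -> v != w -> exists2 y : 'cV['F_2]_n, w^T *m y = 0 & v^T *m y = 1.
Proof.
move=> v0; rewrite -addm_eq0 => vw.
have [y1 v1] := dot_neq0 v0; have [y2 vw2] := dot_neq0 vw.
case: (mx11_case (w^T *m y1)) => w1; first by exists y1.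
move: vw2; rewrite trmxD mulmxDl.
case: (mx11_case (w^T *m y2)) => w2; rewrite w2 ?addr0 => v2; first by exists y2.
exists (y1 + y2); first by rewrite mulmxDr w1 w2 addmm.
rewrite mulmxDr v1 (_ : v^T *m y2 = 0) ?addr0 //.
by move: v2 => /(canRL (addrK _)); rewrite subrr.
Qed.

Lemma dg_invmx (n : nat) (A : 'M['F_2]_n) :
  A^T = A -> A \in unitmx -> A *m dg (invmx A) = dg A.
Proof.
move=> symA Au; have := dg_conj (invmx A) symA.
by rewrite sym_invmx // mulVmx // mul1mx => ->; rewrite mulKVmx.
Qed.

Lemma sym_submxP (n : nat) (N : 'M['F_2]_n) (y : 'cV['F_2]_n) :
  N^T = N -> reflect (exists q, y = N *m q) (y^T <= N)%MS.
Proof.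
move=> symN; apply: (iffP submxP) => [[D e]|[q ->]].
  by exists D^T; apply: trmx_inj; rewrite e trmx_mul trmxK symN.
by exists q^T; rewrite trmx_mul symN.
Qed.

Lemma dot_self (n : nat) (v : 'cV['F_2]_n) : v^T *m v = (const_mx 1)^T *m v.
Proof. by rewrite -{1}[v^T]mulmx1 quad_dg ?trmx1 // dg1. Qed.

(** The vector y is the first step from [A]: [w.y = 0] keeps [A + y y^T] invertible, and y outside
    the image of [N] raises the rank. The vector p serves in [rank_gt1_isotropic] to show that the
    square of [N + y y^T] has rank at least 2. *)
Lemma extension_vector (n : nat) (A : 'M['F_2]_n) :
  let N := A - 1%:M in let w := dg (invmx A) in
  SGL A -> dg N = 0 -> (1 < \rank N)%N -> ((\rank N).+1 < n)%N ->
  exists y p : 'cV['F_2]_n,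
    [/\ w^T *m y = 0, ~~ (y^T <= N)%MS, (N *m p)^T *m (N *m p) = 0 &
        (exists q, (N *m p)^T *m (N *m q) = 1) \/ (N *m p)^T *m y = 1].
Proof.
move=> N w /SGL_symP[symA Au] dN r1 rn.
have symN : N^T = N by rewrite /N oppmx2; apply: symD; rewrite ?trmx1.
case: (boolP [exists p : 'cV['F_2]_n, [exists q : 'cV['F_2]_n,
         ((N *m p)^T *m (N *m p) == 0) && ((N *m p)^T *m (N *m q) == 1)]]).
  move=> /existsP[p /existsP[q /andP[/eqP pp /eqP pq]]].
  (* The orthogonal complement of [w] has dimension at least n - 1, too large to lie in the image of
     [N]; any y in it outside that image works. *)
  have : ~~ (kermx w <= N)%MS.
    apply: contraL rn => /mxrankS; rewrite mxrank_ker -leqNgt.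
    by move=> h; rewrite -[(\rank N).+1]add1n -leq_subLR;
      apply: leq_trans h; rewrite leq_sub2l ?rank_leq_col.
  case/row_subPn=> i iN; exists (row i (kermx w))^T, p; split=> //.
  - by rewrite dotC trmxK -row_mul mulmx_ker row0.
  - by rewrite trmxK.
  - by left; exists q.
rewrite negb_exists => /forallP iso.
have {}iso (p q : 'cV['F_2]_n) : (N *m p)^T *m (N *m p) = 0 -> (N *m p)^T *m (N *m q) = 0.
  move=> pp; move: (iso p); rewrite negb_exists => /forallP/(_ q).
  by rewrite pp eqxx /=; case: (mx11_case ((N *m p)^T *m (N *m q))) => -> //; rewrite eqxx.
set o : 'cV['F_2]_n := const_mx 1.
(* A vector of im N isotropic for the dot product is orthogonal to im N, hence
   in the kernel of N; for w this forces w = A w = 1. *)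
have w_isotropic (p0 : 'cV['F_2]_n) : N *m p0 = w -> w^T *m w = 0 ->
    forall p : 'cV['F_2]_n, o^T *m (N *m p) = 0.
  move=> ep0 ww p.
  have Nw : N *m w = 0.
    apply: trmx_inj; rewrite trmx_mul symN trmx0; apply: eq_mulmx_cV => q.
    by rewrite mul0mx -mulmxA -ep0; apply: iso; rewrite ep0.
  have ow : o = w.
    have := dg_invmx symA Au; rewrite -/w.
    have -> : A = N + 1%:M by rewrite subrK.
    by rewrite mulmxDl Nw mul1mx add0r dgD dN dg1 add0r => ->.
  by rewrite ow -ep0; apply: iso; rewrite ep0.
(* Otherwise 0 and [w] are the only possible isotropic vectors of the image. If the whole image is
   isotropic, it lies in {0, w}; if not, [w_isotropic] rules out [w], and any two non-isotropic
   vectors coincide, their sum being isotropic. Either way the rank is at most one. *)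
have [p [pp p0 pw]] : exists p : 'cV['F_2]_n,
    [/\ (N *m p)^T *m (N *m p) = 0, N *m p != 0 & N *m p != w].
  case: (pickP (fun p : 'cV['F_2]_n =>
    [&& (N *m p)^T *m (N *m p) == 0, N *m p != 0 & N *m p != w])).
    by move=> p /and3P[/eqP]; exists p.
  move=> h; exfalso; move: r1; apply/negP; rewrite -leqNgt.
  have {}h (p : 'cV['F_2]_n) : (N *m p)^T *m (N *m p) = 0 -> N *m p = 0 \/ N *m p = w.
    move=> pp; move: (h p); rewrite pp eqxx /=.
    by case: eqP => [|_]; [left | case: eqP => // ->; right].
  case: (pickP (fun p : 'cV['F_2]_n => o^T *m (N *m p) != 0)) => [p0 /mx11_neq0 op0|ho].
    have {}h (p : 'cV['F_2]_n) : (N *m p)^T *m (N *m p) = 0 -> N *m p = 0.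
      move=> pp; case: (h p pp) => // e; move: (w_isotropic p e); rewrite -{1 2}e pp.
      by move=> /(_ erefl p0)/eqP; rewrite op0 oner_eq0.
    apply: (@rank_le1_two_values _ _ (N *m p0)) => p.
    case: (mx11_case (o^T *m (N *m p))) => op; [left|right].
      by apply: h; rewrite dot_self.
    have /h : (N *m (p + p0))^T *m (N *m (p + p0)) = 0.
      by rewrite dot_self mulmxDr mulmxDr op op0 addmm.
    by rewrite mulmxDr => /eqP; rewrite addm_eq0 => /eqP.
  apply: (@rank_le1_two_values _ _ w) => p; apply: h; rewrite dot_self.
  by apply/eqP; move: (ho p) => /negbT; rewrite negbK.
have [y wy py] := separating_vector p0 pw.
exists y, p; split=> //; last by right.
apply/negP=> /(sym_submxP _ symN)[q eq]; move/eqP: py.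
by rewrite eq iso // eq_sym oner_eq0.
Qed.

(** As y is outside the image of the symmetric [N], some z in the kernel of [N] has [y.z = 1]. The
    new matrix sends z to y, and adding z to p when [y.p = 1] recovers [N p]. *)
Lemma rank_add_outer (n : nat) (N : 'M['F_2]_n) (y : 'cV['F_2]_n) :
  N^T = N -> ~~ (y^T <= N)%MS ->
  [/\ \rank (N + y *m y^T)%R = (\rank N).+1,
      exists z, (N + y *m y^T) *m z = y &
      forall p : 'cV['F_2]_n, exists q, (N + y *m y^T) *m q = N *m p].
Proof.
move=> symN yN; set N' := N + y *m y^T.
have symN' : N'^T = N' by apply/symD/sym_outer.
have [z [Nz yz]] : exists z : 'cV['F_2]_n, N *m z = 0 /\ y^T *m z = 1.
  move: yN; rewrite submxE => /rV0Pn[j yj].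
  exists (cokermx N *m delta_mx j 0); rewrite (mulmxA N) (mulmxA y^T).
  rewrite mulmx_coker mul0mx; split=> //.
  apply: mx11_neq0; apply: contra yj; rewrite -colE => /eqP/matrixP/(_ 0 0).
  by rewrite !mxE => ->.
have N'z : N' *m z = y by rewrite mulmxDl Nz add0r -mulmxA yz mulmx1.
have N'N (p : 'cV['F_2]_n) : exists q, N' *m q = N *m p.
  have N'E (q : 'cV['F_2]_n) : y^T *m q = 0 -> N' *m q = N *m q.
    by move=> yq; rewrite mulmxDl -mulmxA yq mulmx0 addr0.
  case: (mx11_case (y^T *m p)) => yp; first by exists p; rewrite N'E.
  exists (p + z); rewrite N'E; first by rewrite mulmxDr Nz addr0.
  by rewrite mulmxDr yp yz addmm.
split=> //; last by exists z.
apply/eqP; rewrite eqn_leq; apply/andP; split.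
  apply: leq_trans (mxrank_add _ _) _; rewrite -[X in (_ <= X)%N]addn1 leq_add2l.
  exact: rank_outer_le.
apply: rank_ltmx; rewrite ltmxE; apply/andP; split.
  apply/row_subP=> i; rewrite -[row i N]trmxK; apply/(sym_submxP _ symN').
  have [q eq] := N'N (delta_mx i 0); exists q.
  by rewrite eq tr_row symN colE.
apply: contra yN; apply: submx_trans.
by apply/(sym_submxP _ symN'); exists z.
Qed.

Lemma SGL_walk_alternate (n : nat) (A : 'M['F_2]_n) :
  SGL A -> dg (A - 1%:M) = 0 -> (1 < \rank (A - 1%:M)%R)%N ->
  ((\rank (A - 1%:M)%R).+1 < n)%N ->
  walkn (@SGL n) (@rank1_adj n) (\rank (A - 1%:M)).+2 A 1%:M.
Proof.
move=> sglA dN r1 rn; have [symA Au] := SGL_symP _ sglA.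
have [y [p [wy yN pp pq]]] := extension_vector sglA dN r1 rn.
set N := A - 1%:M in dN r1 rn yN pp pq *.
have symN : N^T = N by rewrite /N oppmx2; apply: symD; rewrite ?trmx1.
have [rN' [z N'z] N'N] := rank_add_outer symN yN.
have yAy : y^T *m invmx A *m y = 0 by rewrite quad_dg // sym_invmx.
have [Bu _] := add_outer_unit Au yAy.
set B := A + y *m y^T in Bu.
have eN' : N + y *m y^T = B - 1%:M by rewrite /B /N addrAC.
rewrite eN' in rN' N'z N'N.
have sglB : SGL B by apply/SGL_symP; split=> //; exact/symD/sym_outer.
have y0 : y != 0 by apply: contra yN => /eqP->; rewrite trmx0 sub0mx.
have wB : walkn (@SGL n) (@rank1_adj n) (\rank N).+1 B 1%:M; last first.
  rewrite /= sglA; apply/existsP; exists B; rewrite rank1_adj_outer //.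
apply: walkn_rev; first exact: rank1_adj_sym.
apply: SGL_walk_from_id => //.
  by rewrite /= alternate_rank_even.
set N' := B - 1%:M in rN' N'z N'N *.
have symN' : N'^T = N' by rewrite /N' -eN'; apply/symD/sym_outer.
have [p' ep] := N'N p.
have [q' pq'] : exists q' : 'cV['F_2]_n, (N *m p)^T *m (N' *m q') = 1.
  case: pq => [[q pq]|py]; last by exists z; rewrite N'z.
  by have [q' eq] := N'N q; exists q'; rewrite eq.
apply: (@rank_gt1_isotropic _ _ p' q'); first exact: sym_mulmx_self.
  by rewrite -pp -ep trmx_mul symN' !mulmxA.
by rewrite -pq' -ep trmx_mul symN' !mulmxA.
Qed.

(** By Sylvester's inequality the square of [A - 1] has rank at least [2 rank(A - 1) - n > 1]. *)
Lemma SGL_walk_large_odd_rank (n : nat) (A : 'M['F_2]_n) :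
  SGL A -> odd (\rank (A - 1%:M)) -> (n.+1 < \rank (A - 1%:M)%R + \rank (A - 1%:M)%R)%N ->
  walkn (@SGL n) (@rank1_adj n) (\rank (A - 1%:M)) A 1%:M.
Proof.
move=> sglA oddr rn; apply: walkn_rev; first exact: rank1_adj_sym.
apply: SGL_walk_from_id => //.
by apply: leq_trans (mxrank_mul_min _ _); rewrite ltn_subRL addn1.
Qed.

(** * The distance among symmetric matrices, and the two descriptions *)

Lemma dhat_nonalternate (n : nat) (A B : 'M['F_2]_n) :
  A^T = A -> B^T = B -> dg (A - B) != 0 -> dhat_is A B (\rank (A - B)).
Proof.
move=> symA symB dN; apply/andP; split; first exact: dhat_le_rank.
apply/forallP=> j; apply/negP=> /walkn_rank_le.
by rewrite leqNgt ltn_ord.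
Qed.

Lemma dhat_alternate (n : nat) (A B : 'M['F_2]_n) :
  A^T = A -> B^T = B -> dg (A - B) = 0 -> (0 < \rank (A - B)%R)%N ->
  dhat_is A B (\rank (A - B)).+1.
Proof.
move=> symA symB dN r0; apply/andP; split; first exact: dhat_le_rank_alternate.
apply/forallP=> j; apply/negP=> w; have rj := walkn_rank_le w.
have := walkn_alternate_rank_lt (leq_trans r0 rj) w dN.
by rewrite ltnNge -ltnS ltn_ord.
Qed.

Theorem theorem8p5 (n : nat) (hn : (3 <= n)%N) (hodd : odd n) :
  (odd ((n + 1) %/ 2) ->
     forall A : 'M['F_2]_n,
       SD A <-> [/\ SGL A, d_is A 1%:M ((n + 5) %/ 2) & dhat_is A 1%:M ((n + 1) %/ 2)])
  /\
  (~~ odd ((n + 1) %/ 2) ->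
     forall A : 'M['F_2]_n,
       SD A <-> [/\ SGL A, d_is A 1%:M ((n + 5) %/ 2) &
                   dhat_is A 1%:M ((n + 1) %/ 2) \/ dhat_is A 1%:M ((n + 3) %/ 2)]).
Proof.
(* With [n = 2m - 1], the three quotients are m, m + 1 and m + 2. *)
pose m := n./2.+1.
have en : n = (m.*2).-1 by rewrite /m doubleS /= -{1}(odd_double_half n) hodd.
have m1 : (1 < m)%N by rewrite /m ltnS; case: (n) hn => [|[|[|k]]].
have e1 : ((n + 1) %/ 2 = m)%N.
  by rewrite divn2 addn1 /= uphalf_half hodd add1n.
have e3 : ((n + 3) %/ 2 = m.+1)%N by rewrite -(addn1 m) -e1 -divnDMl //= mul1n -addnA.
have e5 : ((n + 5) %/ 2 = m.+2)%N by rewrite -(addn2 m) -e1 -divnDMl //= -addnA.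
rewrite /SD e1 e3 e5 => {e1 e3 e5}.
have sym1 : (1%:M : 'M['F_2]_n)^T = 1%:M by rewrite trmx1.
have dhat_nonalt (A : 'M['F_2]_n) k : SGL A -> dg (A - 1%:M) != 0 ->
    dhat_is A 1%:M k -> \rank (A - 1%:M) = k.
  move=> /SGL_symP[symA _] dN; apply: gdist_is_uniq.
  exact: dhat_nonalternate.
have dhat_alt (A : 'M['F_2]_n) k : SGL A -> dg (A - 1%:M) = 0 -> (0 < k)%N ->
    dhat_is A 1%:M k.+1 -> \rank (A - 1%:M) = k.
  move=> /SGL_symP[symA _] dN k0 hk; case: (posnP (\rank (A - 1%:M))) => [r0|r0].
    have A1 : A = 1%:M by apply/eqP; rewrite -subr_eq0 -mxrank_eq0 r0.
    have : walkn (@symF2 n) (@rank1_adj n) 0 A 1%:M.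
      by rewrite /= A1 /symF2 sym1 !eqxx.
    by move/(gdist_is_le hk).
  by apply: succn_inj; apply: gdist_is_uniq hk; apply: dhat_alternate.
have alt_even (A : 'M['F_2]_n) : SGL A -> dg (A - 1%:M) = 0 -> ~~ odd (\rank (A - 1%:M)).
  move=> /SGL_symP[symA _]; apply: alternate_rank_even.
  by rewrite oppmx2 symD.
split=> [oddm|evm] A; split.
- case/and3P=> sglA dA /eqP rA; split=> //.
  have [symA _] := SGL_symP _ sglA.
  rewrite -rA; apply: dhat_nonalternate => //.
  by apply: contraL oddm => /eqP /(alt_even _ sglA); rewrite rA.
- case=> sglA dA hA; apply/and3P; split=> //; apply/eqP.
  case: (eqVneq (dg (A - 1%:M)) 0) => dN; last exact: dhat_nonalt.
  (* Here [A - 1] is alternate of rank m - 1, which is at least 2 since m is odd and above 1;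
     [SGL_walk_alternate] gives a walk of length m + 1, shorter than the distance m + 2. *)
  exfalso; have m2 : (1 < m.-1)%N by case: (m) m1 oddm => [|[|[|]]].
  have rA : \rank (A - 1%:M) = m.-1.
    by apply: dhat_alt.
  have : walkn (@SGL n) (@rank1_adj n) m.+1 A 1%:M.
    rewrite -[m.+1]/(m.-1).+2 -rA; apply: SGL_walk_alternate => //; rewrite rA //.
    have aux k : (2 < k)%N -> (k < k.*2.-1)%N.
      by case: k => [|[|[|k]]] // _; rewrite !doubleS /= !ltnS -addnn leqW ?leq_addr.
    by rewrite [X in (_ < X)%N]en; apply: aux.
  by move/(gdist_is_le dA); rewrite ltnn.
- case/and3P=> sglA dA /eqP rA; split=> //.
  have [symA _] := SGL_symP _ sglA.
  case: (eqVneq (dg (A - 1%:M)) 0) => dN; [right|left]; rewrite -rA.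
    by apply: dhat_alternate => //; rewrite rA ltnW.
  exact: dhat_nonalternate.
case=> sglA dA hA; apply/and3P; split=> //; apply/eqP.
have [symA _] := SGL_symP _ sglA.
case: (eqVneq (dg (A - 1%:M)) 0) => dN.
  case: hA => hA; last by apply: dhat_alt => //; apply: ltnW.
  have rA : \rank (A - 1%:M) = m.-1.
    by apply: dhat_alt.
  (* For even m the rank m - 1 is odd, impossible for an alternate matrix. *)
  exfalso; move: (alt_even A sglA dN); rewrite rA; case: (m) m1 evm => //= k _.
  by rewrite negbK => ->.
case: hA => hA; first exact: dhat_nonalt.
have rA := dhat_nonalt _ _ sglA dN hA.
(* The rank m + 1 is odd and [2(m + 1) > n + 1], so there is a walk of length m + 1, again too
   short. *)
exfalso; have : walkn (@SGL n) (@rank1_adj n) m.+1 A 1%:M.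
  rewrite -rA; apply: SGL_walk_large_odd_rank => //; rewrite rA //=.
  have aux k : (0 < k)%N -> (k.*2.-1.+1 < k.+1 + k.+1)%N.
    by move=> k0; rewrite prednK ?double_gt0 // addSn addnS addnn ltnS leqnSn.
  by rewrite [X in (X.+1 < _)%N]en; apply: aux.
by move/(gdist_is_le dA); rewrite ltnn.
Qed.
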